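(* Let $G$ be the polynomial grammar, i.e. the probabilistic context-free grammar with start symbol $E$, non-terminals $E,V,F$, terminals $\texttt{c},\texttt{+},\texttt{x}_1,\dots,\texttt{x}_n$ and rules (probabilities in brackets) $$E\to E\,\texttt{+}\,\texttt{c}V\ [p]\mid \texttt{c}\ [1-p],\qquad V\to VF\ [q]\mid F\ [1-q],\qquad F\to \texttt{x}_1\ [q_1]\mid\dots\mid\texttt{x}_n\ [q_n].$$ (a) The probability of deriving the expression $x_1^{m_1}\cdots x_n^{m_n}$ from $V$ (i.e. of deriving from $V$ any string with exactly $m_i$ occurrences of $\texttt{x}_i$ for each $i$) equals, with $M=m_1+\dots+m_n$, $$\pi(m_1,\dots,m_n)=\binom{M}{m_1,\dots,m_n}q^{M-1}(1-q)\,q_1^{m_1}\cdots q_n^{m_n}.$$ (b) The computation of the probability $P([w])$ of the expression of a string $w=\texttt{c}+\texttt{c}\,x_1^{m_{1,1}}\cdots x_n^{m_{n,1}}+\dots+\texttt{c}\,x_1^{m_{1,k}}\cdots x_n^{m_{n,k}}$ with $k$ different monomials translates to the same problem for a linear grammar: each monomial is regarded as a single terminal symbol, and the derivations of it from $V$ are replaced by a single rule $V\to x_1^{m_1}\cdots x_n^{m_n}$ of probability $\pi(m_1,\dots,m_n)$ (giving a countable set of rules for $V$ and of terminals). Consequently, with $\pi_j=\pi(m_{1,j},\dots,m_{n,j})$, the formula for linear grammars gives $$P([w])=\sum_{I\subseteq\{1,\dots,k\}}(-1)^{|I|}\,\frac{1-p}{1-p\sum_{j\in\{1,\dots,k\}\setminus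 I}\pi_j}.$$
   Context: In a probabilistic context-free grammar the rule probabilities lie in $[0,1]$ and, for each non-terminal, sum to $1$. A parse tree has as root the start symbol (or $V$, for derivations from $V$), leaves terminals, and the children of an internal node $A$ are, in order, the symbols of the right-hand side of some rule for $A$; its string is the left-to-right sequence of its leaves; its probability is the product, with multiplicity, of the probabilities of the rules used. $L(G)$ is the set of derivable terminal strings, and $P(v)$ is the sum of the probabilities of all parse trees with string $v$. In writing strings, $x_1^{m_1}\cdots x_n^{m_n}$ abbreviates a sequence of $M\ge 1$ variable symbols containing $\texttt{x}_i$ exactly $m_i$ times; juxtaposition means multiplication. Expressions: let $D$ be the domain of the variables $x_1,\dots,x_n$ and $\mathbb F$ the domain of the free constants, denoted by the symbol $\texttt{c}$. For $v\in L(G)$ with exactly $m$ occurrences of $\texttt{c}$ and $c_1,\dots,c_m\in\mathbb F$, let $f_{v,c_1,\dots,c_m}$ be the function of $(x_1,\dots,x_n)$ obtained by replacing the $i$-th occurrence of $\texttt{c}$ by $c_i$ and each $\texttt{x}_j$ by $x_j$, on the largest possible domain. Let $\Phi(v)=\{f_{v,c_1,\dots,c_m}: c_1,\dots,c_m\in\mathbb F\}$, $v\sim w$ iff $\Phi(v)=\Phi(w)$, $[w]=\{v\in L(G): v\sim w\}$, and $P([w])=\sum_{v\in[w]}P(v)$. Linear grammar: $E\to E\,\texttt{+}\,\texttt{c}V\ [p]\mid\texttt{c}\ [1-p]$, $V\to\texttt{x}_1\ [q_1]\mid\dots\mid\texttt{x}_n\ [q_n]$. For it, the formula for $w=\texttt{c}+\texttt{c}\,\texttt{x}_{r_1}+\dots+\texttt{c}\,\texttt{x}_{r_k}$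 with $r_1<\dots<r_k$ is $P([w])=\sum_{I\subseteq\{1,\dots,k\}}(-1)^{|I|}\frac{1-p}{1-p\sum_{i\in\{1,\dots,k\}\setminus I}q_{r_i}}$.
   Formalization: The formal statement takes D to be an infinite subset of a field and F a subset of it with F + F = F and a nonzero element; for arbitrary D and F the claim fails, e.g. x² = x as functions when D = F = GF(2), or c x + c x differs from c x when F = {1}. *)

(* Defs.v *)
From HB Require Import structures.
From mathcomp Require Import all_boot all_order all_algebra.
From mathcomp Require Import all_classical all_reals all_analysis.

Set Implicit Arguments.
Unset Strict Implicit.
Unset Printing Implicit Defensive.

Import Order.TTheory GRing.Theory Num.Theory.
Local Open Scope classical_set_scope.
Local Open Scope ring_scope.

(** * Probabilistic context-free grammars *)

(* N : non-terminals, T : terminals.  Rules are indexed by a type, which may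
   be infinite; in the grammars below distinct indices have distinct pairs
   (lhs, rhs), so a parse tree is determined by the symbols it carries. *)
Record grammar (R : realType) (N : Type) (T : choiceType) := Grammar {
  start : N;
  rule : choiceType;
  lhs : rule -> N;
  rhs : rule -> seq (N + T);
  prob : rule -> R
}.

Definition is_pcfg (R : realType) (N : Type) (T : choiceType)
    (G : grammar R N T) : Prop :=
  (forall r : rule G, 0 <= prob r <= 1) /\
  (forall A : N, \esum_(r in [set r : rule G | lhs r = A]) (prob r)%:E = 1%:E).

Inductive parse_tree (R : realType) (N : Type) (T : choiceType)
    (G : grammar R N T) : Type :=
| Leaf of T
| Node of rule G & seq (parse_tree G).

Arguments Leaf {R N T G}.

HB.instance Definition _ R N T (G : grammar R N T) :=
  gen_eqMixin (parse_tree G).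
HB.instance Definition _ R N T (G : grammar R N T) :=
  gen_choiceMixin (parse_tree G).

Section ParseTrees.
Variables (R : realType) (N : Type) (T : choiceType) (G : grammar R N T).

Definition root_symbol (t : parse_tree G) : N + T :=
  match t with
  | Leaf a => inr a
  | Node r _ => inl (lhs r)
  end.

Fixpoint well_formed (t : parse_tree G) : Prop :=
  match t with
  | Leaf _ => True
  | Node r ts =>
      map root_symbol ts = rhs r /\
      foldr (fun t' P => well_formed t' /\ P) True ts
  end.

Fixpoint tree_string (t : parse_tree G) : seq T :=
  match t with
  | Leaf a => [:: a]
  | Node _ ts => flatten (map tree_string ts)
  end.

Fixpoint tree_prob (t : parse_tree G) : R :=
  match t with
  | Leaf _ => 1
  | Node r ts => prob r * foldr *%R 1 (map tree_prob ts)
  end.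

Definition trees (A : N) (v : seq T) : set (parse_tree G) :=
  [set t | [/\ well_formed t, root_symbol t = inl A & tree_string t = v]].

Definition prob_from (A : N) (v : seq T) : \bar R :=
  (\esum_(t in trees A v) (tree_prob t)%:E)%E.

Definition string_prob (v : seq T) : \bar R := prob_from (start G) v.

Definition language : set (seq T) := [set v | trees (start G) v !=set0].

End ParseTrees.

(** * Expressions *)

Inductive symbol (X : Type) : Type := Const | Plus | Var of X.

Arguments Const {X}.
Arguments Plus {X}.

Definition symbol_code (X : Type) (a : symbol X) : option (option X) :=
  match a with
  | Const => None
  | Plus => Some None
  | Var x => Some (Some x)
  end.

Definition symbol_decode (X : Type) (a : option (option X)) : symbol X :=
  match a with
  | None => Const
  | Some None => Plus
  | Some (Some x) => Var x
  end.

Lemma symbol_codeK (X : Type) : cancel (@symbol_code X) (@symbol_decode X).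
Proof. by case. Qed.

HB.instance Definition _ (X : choiceType) :=
  Choice.copy (symbol X) (can_type (@symbol_codeK X)).

Section Expressions.
Variables (K : fieldType) (X : choiceType).

(* Some a is a value, None the plus sign; the constants are consumed from
   left to right. *)
Fixpoint substitute (x : X -> K) (v : seq (symbol X)) (cs : seq K) :
    seq (option K) :=
  match v with
  | [::] => [::]
  | Const :: v' => Some (head 0 cs) :: substitute x v' (behead cs)
  | Plus :: v' => None :: substitute x v' cs
  | Var j :: v' => Some (x j) :: substitute x v' cs
  end.

(* Juxtaposition is multiplication and binds tighter than the plus sign;
   acc is the product of the part of the current summand already read. *)
Fixpoint eval_from (acc : K) (s : seq (option K)) : K :=
  match s with
  | [::] => acc
  | Some a :: s' => eval_from (acc * a) s'
  | None :: s' => acc + eval_from 1 s'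
  end.

(* Only sums and products occur, so the largest possible domain of the
   function is the whole of X -> D. *)
Definition expr_fun (D : set K) (v : seq (symbol X))
    (cs : (count_mem Const v).-tuple K) : (X -> D) -> K :=
  fun x => eval_from 1 (substitute (fun j => val (x j)) v cs).

Definition Phi (D F : set K) (v : seq (symbol X)) : set ((X -> D) -> K) :=
  [set expr_fun cs | cs in
     [set cs : (count_mem Const v).-tuple K | forall i, F (tnth cs i)]].

Arguments Phi : clear implicits.

Definition expr_equiv (D F : set K) (v w : seq (symbol X)) : Prop :=
  Phi D F v = Phi D F w.

Definition expr_class (R : realType) (N : Type) (G : grammar R N (symbol X))
    (D F : set K) (w : seq (symbol X)) : set (seq (symbol X)) :=
  [set v | language G v /\ expr_equiv D F v w].

Definition expr_prob (R : realType) (N : Type) (G : grammar R N (symbol X))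
    (D F : set K) (w : seq (symbol X)) : \bar R :=
  (\esum_(v in expr_class G D F w) string_prob G v)%E.

End Expressions.

Arguments Phi {K X}.

(* F + F = F says precisely that the sum of two free constants is a free
   constant, i.e. that c x + c x and c x are the same expression; it holds for
   instance for a subfield of K, or for the positive reals. *)
Definition free_constants (K : fieldType) (F : set K) : Prop :=
  [set a + b | a in F & b in F] = F /\ (exists2 a, F a & a != 0).

(* The string c + c u_1 + ... + c u_k, where the u_i are strings of
   variables. *)
Definition sum_string (X : Type) (us : seq (seq X)) : seq (symbol X) :=
  Const :: flatten [seq [:: Plus; Const] ++ map (@Var X) u | u <- us].

(** * Linear grammars *)

Inductive lin_nonterminal : Type := LE | LV.

Inductive lin_rule (X : Type) : Type :=
| LE_sum
| LE_const
| LV_var of X.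

Arguments LE_sum {X}.
Arguments LE_const {X}.

HB.instance Definition _ X := gen_eqMixin (lin_rule X).
HB.instance Definition _ X := gen_choiceMixin (lin_rule X).

Definition linear_grammar (R : realType) (X : choiceType) (p : R) (qs : X -> R) :
    grammar R lin_nonterminal (symbol X) :=
  {| start := LE;
     rule := lin_rule X;
     lhs := fun r =>
       match r with LE_sum | LE_const => LE | LV_var _ => LV end;
     rhs := fun r =>
       match r with
       | LE_sum => [:: inl LE; inr Plus; inr Const; inl LV]
       | LE_const => [:: inr Const]
       | LV_var x => [:: inr (Var x)]
       end;
     prob := fun r =>
       match r with
       | LE_sum => p
       | LE_const => 1 - p
       | LV_var x => qs x
       end |}.

(** * The polynomial grammar *)

Inductive poly_nonterminal : Type := PE | PV | PF.

Inductive poly_rule (n : nat) : Type :=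
| PE_sum
| PE_const
| PV_mul
| PV_factor
| PF_var of 'I_n.

Arguments PE_sum {n}.
Arguments PE_const {n}.
Arguments PV_mul {n}.
Arguments PV_factor {n}.

HB.instance Definition _ n := gen_eqMixin (poly_rule n).
HB.instance Definition _ n := gen_choiceMixin (poly_rule n).

Definition polynomial_grammar (R : realType) (n : nat) (p q : R)
    (qs : 'I_n -> R) : grammar R poly_nonterminal (symbol 'I_n) :=
  {| start := PE;
     rule := poly_rule n;
     lhs := fun r =>
       match r with
       | PE_sum | PE_const => PE
       | PV_mul | PV_factor => PV
       | PF_var _ => PF
       end;
     rhs := fun r =>
       match r with
       | PE_sum => [:: inl PE; inr Plus; inr Const; inl PV]
       | PE_const => [:: inr Const]
       | PV_mul => [:: inl PV; inl PF]
       | PV_factor => [:: inl PF]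
       | PF_var i => [:: inr (Var i)]
       end;
     prob := fun r =>
       match r with
       | PE_sum => p
       | PE_const => 1 - p
       | PV_mul => q
       | PV_factor => 1 - q
       | PF_var i => qs i
       end |}.

(* Exponent vectors (m_1, ..., m_n) with M = m_1 + ... + m_n >= 1. *)
Definition monomial (n : nat) : choiceType :=
  {m : {ffun 'I_n -> nat} | (0 < \sum_i m i)%N}.

Definition monomial_prob (R : realType) (n : nat) (q : R) (qs : 'I_n -> R)
    (m : monomial n) : R :=
  let M := (\sum_i val m i)%N in
  M`!%:R / (\prod_i (val m i)`!%:R) * q ^+ M.-1 * (1 - q) *
  \prod_i qs i ^+ val m i.

(* The strings of variable symbols abbreviated by x_1^{m_1} ... x_n^{m_n}. *)
Definition spells (n : nat) (u : seq 'I_n) (m : monomial n) : Prop :=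
  forall i, count_mem i u = val m i.

(* Main.v *)
Require Import Defs.
From mathcomp Require Import all_boot all_order all_algebra.
From mathcomp Require Import all_classical all_reals all_analysis.
Import Order.TTheory GRing.Theory Num.Theory.
Local Open Scope classical_set_scope.
Local Open Scope ring_scope.
Set Implicit Arguments.
Unset Strict Implicit.
Unset Printing Implicit Defensive.

(** A parse tree of the polynomial grammar is determined by the sequence of
    nonempty words u_1, ..., u_l over the variables which it adds up, and a
    word of length M has exactly one tree from V, of probability
    q^(M-1) (1-q) prod_i q_i^(m_i); part (a) counts words with prescribed
    letter multiplicities.  As the variables range over an infinite set and
    F + F = F, such a sum determines, and is determined by, the set of
    monomials that occur in it.  Grouping the words by their monomials turns
    P([w]) into a sum over sequences of monomials, which is the sum for the
    linear grammar.  The sequences of length l whose set of entries is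
    {m_1, ..., m_k} are counted by inclusion-exclusion on the missing
    monomials, and summing over l gives geometric series. *)

(** * Sums of monomials and their parse trees *)

Section SumString.
Variable X : Type.

(* Returns the variables in front of the first plus sign, and those of each
   of the following summands. *)
Fixpoint parse_sum (v : seq (symbol X)) : seq X * seq (seq X) :=
  match v with
  | [::] => ([::], [::])
  | Const :: v' => parse_sum v'
  | Plus :: v' => ([::], (parse_sum v').1 :: (parse_sum v').2)
  | Var x :: v' => (x :: (parse_sum v').1, (parse_sum v').2)
  end.

Lemma parse_sumK (us : seq (seq X)) : (parse_sum (sum_string us)).2 = us.
Proof.
rewrite /sum_string /=; set f := fun _ => _.
(* The word [u] is recovered exactly when [s] has no variables before its first plus sign; the
   flattened remaining summands always satisfy this. *)
have Hcat u s : (parse_sum s).1 = [::] ->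
    parse_sum (map (@Var X) u ++ s) = (u, (parse_sum s).2).
  by move=> s0; elim: u => [|x u /= -> //]; case: (parse_sum s) s0 => /= a b ->.
suff -> : parse_sum (flatten (map f us)) = ([::], us) by [].
by elim: us => //= u us IH; rewrite Hcat IH.
Qed.

Lemma sum_string_inj : injective (@sum_string X).
Proof. by move=> us vs e; rewrite -[us]parse_sumK e parse_sumK. Qed.

Lemma sum_string_rcons (us : seq (seq X)) u :
  sum_string (rcons us u) = sum_string us ++ [:: Plus; Const] ++ map (@Var X) u.
Proof. by rewrite /sum_string map_rcons flatten_rcons. Qed.

End SumString.

Lemma map_Var_inj (X : Type) : injective (map (@Var X)).
Proof. by apply: inj_map => x y []. Qed.

(** * Grammars whose start symbol generates sums: the linear and the polynomial case at once *)

Section SumGrammar.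
Variables (R : realType) (N : Type) (X : choiceType).
Variables (G : grammar R N (symbol X)) (V : N) (rsum rconst : rule G) (p : R).
Hypotheses (lhs_sum : lhs rsum = start G) (lhs_const : lhs rconst = start G).
Hypothesis lhs_start :
  forall r : rule G, lhs r = start G -> r = rsum \/ r = rconst.
Hypothesis rhs_sum : rhs rsum = [:: inl (start G); inr Plus; inr Const; inl V].
Hypothesis rhs_const : rhs rconst = [:: inr Const].
Hypotheses (prob_sum : prob rsum = p) (prob_const : prob rconst = 1 - p).
Hypothesis p01 : 0 <= p <= 1.

(* U indexes the parse trees with root V: the tree of u has string str u. *)
Variables (U : choiceType) (str : U -> seq X) (tree : U -> parse_tree G).
Variable wt : U -> R.
Hypothesis str_inj : injective str.
Hypothesis tree_wf : forall u, well_formed (tree u).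
Hypothesis tree_root : forall u, root_symbol (tree u) = inl V.
Hypothesis tree_str : forall u, tree_string (tree u) = map (@Var X) (str u).
Hypothesis tree_wt : forall u, tree_prob (tree u) = wt u.
Hypothesis tree_surj : forall t : parse_tree G,
  well_formed t -> root_symbol t = inl V -> exists u, t = tree u.
Hypothesis wt_ge0 : forall u, 0 <= wt u.

(** The rule for E is left recursive, so the root carries the last summand; hence the left fold here
    and the inductions from the right below. *)
Definition sum_tree (us : seq U) : parse_tree G :=
  foldl (fun t u => Node rsum [:: t; Leaf Plus; Leaf Const; tree u])
    (Node rconst [:: Leaf Const]) us.

Lemma sum_tree_root us : root_symbol (sum_tree us) = inl (start G).
Proof.
by elim/last_ind: us => [|us u _]; rewrite /sum_tree ?foldl_rcons /=
  ?lhs_const ?lhs_sum.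
Qed.

Lemma sum_tree_wf us : well_formed (sum_tree us).
Proof.
elim/last_ind: us => [|us u IH]; first by rewrite /= rhs_const.
rewrite /sum_tree foldl_rcons -/(sum_tree us) /= rhs_sum sum_tree_root.
by rewrite tree_root; split=> //; do 4!split=> //.
Qed.

Lemma sum_tree_string us :
  tree_string (sum_tree us) = sum_string (map str us).
Proof.
elim/last_ind: us => [//|us u IH].
rewrite /sum_tree foldl_rcons -/(sum_tree us) /= map_rcons sum_string_rcons.
by rewrite IH tree_str /= cats0.
Qed.

Lemma sum_tree_prob us :
  tree_prob (sum_tree us) =
  (1 - p) * p ^+ size us * \prod_(u <- us) wt u.
Proof.
elim/last_ind: us => [|us u IH].
  by rewrite /= big_nil prob_const expr0 !mulr1.
rewrite /sum_tree foldl_rcons -/(sum_tree us) /= prob_sum IH tree_wt.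
rewrite size_rcons exprS -cats1 big_cat big_seq1 /= !mul1r mulr1.
by rewrite !mulrA [p * _]mulrC.
Qed.

Lemma sum_tree_surj (t : parse_tree G) :
  well_formed t -> root_symbol t = inl (start G) -> exists us, t = sum_tree us.
Proof.
(* Parse trees are nested through [seq], so the recursion is made explicit; it descends into the
   first child, the only one with root E. *)
move: t; fix IH 1 => -[//|r ts] /= [rs wfs] [/lhs_start[]] er; subst r.
- move: rs wfs; rewrite rhs_sum.
  case: ts => [//|t1 [//|t2 [//|t3 [//|t4 [|//]]]]] /= [r1 r2 r3 r4].
  move=> [w1 [_ [_ [w4 _]]]].
  have [us ->] := IH t1 w1 r1; have [u ->] := tree_surj w4 r4.
  case: t2 r2 => // _ [->]; case: t3 r3 => // _ [->].
  by exists (rcons us u); rewrite /sum_tree foldl_rcons.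
- move: rs wfs; rewrite rhs_const.
  by case: ts => [//|[a|//] [|//]] [->] _; exists [::].
Qed.

(** Unambiguity: the string determines the words, by [sum_string_inj] and [str_inj], and these
    determine the tree. Hence each P(v) is a single product. *)
Lemma trees_sum_string us :
  trees (G := G) (start G) (sum_string (map str us)) = [set sum_tree us].
Proof.
apply/seteqP; split=> t /=.
  case=> wf /(sum_tree_surj wf)[vs ->]; rewrite sum_tree_string.
  by move=> /sum_string_inj/(inj_map str_inj) ->.
by move=> ->; split; [exact: sum_tree_wf|exact: sum_tree_root
  |exact: sum_tree_string].
Qed.

Lemma language_sum_string :
  language G = [set sum_string (map str us) | us in setT].
Proof.
apply/seteqP; split=> v /=.
  case=> t [/sum_tree_surj /[apply] -[us ->] <-]; exists us => //.
  by rewrite sum_tree_string.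
by case=> us _ <-; rewrite /language /= trees_sum_string; exists (sum_tree us).
Qed.

Lemma sum_tree_prob_ge0 us : 0 <= (1 - p) * p ^+ size us * \prod_(u <- us) wt u.
Proof.
have /andP[p0 p1] := p01.
by rewrite !mulr_ge0 ?exprn_ge0 ?subr_ge0// prodr_ge0.
Qed.

Lemma string_prob_sum_string us :
  string_prob G (sum_string (map str us)) =
  ((1 - p) * p ^+ size us * \prod_(u <- us) wt u)%:E.
Proof.
rewrite /string_prob /prob_from trees_sum_string esum_set1 ?sum_tree_prob//.
by rewrite lee_fin sum_tree_prob_ge0.
Qed.

(** By unambiguity, [us] runs bijectively through the class of w. The map [mo] sends a word to its
    monomial: it is [counts] for the polynomial grammar and the identity for the linear one. *)
Lemma expr_prob_sum_string (K : fieldType) (D F : set K) (Y : eqType)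
    (mo : U -> Y) (ws : seq U) :
  (forall us, expr_equiv D F (sum_string (map str us))
      (sum_string (map str ws)) <-> map mo us =i map mo ws) ->
  expr_prob G D F (sum_string (map str ws)) =
  (\esum_(us in [set us | map mo us =i map mo ws])
     ((1 - p) * p ^+ size us * \prod_(u <- us) wt u)%:E)%E.
Proof.
move=> equivP; rewrite /expr_prob.
rewrite (@reindex_esum _ _ _ [set us | map mo us =i map mo ws] _
  (fun us => sum_string (map str us))).
  by apply: eq_esum => us _; rewrite string_prob_sum_string.
split.
- move=> us /= /equivP; split=> //.
  by rewrite language_sum_string; exists us.
- by move=> us vs _ _ /sum_string_inj/(inj_map str_inj).
- move=> v [] /=; rewrite language_sum_string => -[us _ <-] /equivP ?.
  by exists us.
Qed.

End SumGrammar.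

(** * Equivalence of expressions *)

Section Combinations.
Variables (K : fieldType) (A : Type) (Y : choiceType) (h : Y -> A -> K).
Variable F : set K.
Hypothesis hF : free_constants F.

Definition combinations (ys : seq Y) : set (A -> K) :=
  [set f | exists c cs, [/\ F c, size cs = size ys,
     (forall c', c' \in cs -> F c') &
     f = fun x => c + \sum_(yc <- zip ys cs) yc.2 * h yc.1 x]].

Lemma free_constantsD a b : F a -> F b -> F (a + b).
Proof. by move=> Fa Fb; rewrite -(hF.1); exists a => //; exists b. Qed.

(** Both inclusions of F + F = F are used: the coefficients of a repeated monomial merge into one
    free constant, and conversely one free constant splits over the repetitions. *)
Lemma combinations_undup ys f :
  combinations ys f <->
  exists c (a : Y -> K), [/\ F c, (forall y, F (a y)) &
     f = fun x => c + \sum_(y <- undup ys) a y * h y x].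
Proof.
have [FF [a0 Fa0 _]] := hF.
elim: ys f => [|y ys IH] f.
  split=> [[c [cs [Fc]]]|[c [a [Fc Fa ->]]]].
    (* Coefficients are total functions into F, so monomials that do not occur get the default
       [a0]. *)
    case: cs => //= _ _ ->; exists c, (fun=> a0); split=> //.
    by apply/funext => x; rewrite !big_nil.
  by exists c, [::]; split=> //; apply/funext => x; rewrite /= !big_nil.
split=> [[c [[|b cs]]] [Fc] //= [scs] Fcs ->|].
  have /IH[c1 [a [Fc1 Fa e]]] :
      combinations ys (fun x => c + \sum_(yc <- zip ys cs) yc.2 * h yc.1 x).
    exists c, cs; split=> // c' cs'; apply: Fcs.
    by rewrite inE cs' orbT.
  have Fb : F b by apply: Fcs; rewrite inE eqxx.
  have {}e x : c + \sum_(yc <- zip (y :: ys) (b :: cs)) yc.2 * h yc.1 x =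
      b * h y x + (c1 + \sum_(y' <- undup ys) a y' * h y' x).
    by have := congr1 (fun f => f x) e => /= <-; rewrite big_cons /= addrCA.
  have [yys|yys] := boolP (y \in ys).
    exists c1, (fun y' => if y' == y then a y + b else a y'); split=> //.
      by move=> y'; case: eqP => // _; exact: free_constantsD.
    apply/funext => x; rewrite e addrCA; congr (_ + _).
    rewrite !(bigD1_seq y)/= ?undup_uniq ?mem_undup// eqxx addrA mulrDl.
    congr (_ + _); first by rewrite addrC.
    by apply: eq_bigr => y' /negbTE ->.
  exists c1, (fun y' => if y' == y then b else a y'); split=> //.
    by move=> y'; case: eqP.
  apply/funext => x; rewrite e big_cons eqxx addrCA.
  do 2!congr (_ + _); rewrite big_seq [RHS]big_seq.
  apply: eq_bigr => y'; rewrite mem_undup; case: eqP => // -> yys'.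
  by rewrite yys' in yys.
move=> [c [a [Fc Fa ->]]].
have [yys|yys] := boolP (y \in ys).
  (* Split the coefficient of [y]: [b] goes to the new occurrence, [b'] stays with the earlier
     ones. *)
  have [b Fb [b' Fb' bb']] : [set u + v | u in F & v in F] (a y).
    by rewrite FF.
  have /IH[c1 [cs [Fc1 scs Fcs e]]] : exists c' a', [/\ F c',
      forall y, F (a' y) & (fun x => c +
        \sum_(y' <- undup ys) (if y' == y then b' else a y') * h y' x) =
      fun x => c' + \sum_(y' <- undup ys) a' y' * h y' x].
    exists c, (fun y' => if y' == y then b' else a y'); split=> //.
    by move=> y'; case: eqP.
  exists c1, (b :: cs); split=> //=.
  - by rewrite scs.
  - by move=> c'; rewrite inE => /predU1P[->//|/Fcs].
  apply/funext => x; rewrite big_cons /= addrCA.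
  have := congr1 (fun f => f x) e => /= <-.
  rewrite [RHS]addrCA; congr (_ + _).
  rewrite yys !(bigD1_seq y)/= ?undup_uniq ?mem_undup// eqxx addrA -bb' mulrDl.
  by congr (_ + _); apply: eq_bigr => y' /negbTE ->.
have /IH[c1 [cs [Fc1 scs Fcs e]]] : exists c' a', [/\ F c',
    forall y, F (a' y) & (fun x => c + \sum_(y' <- undup ys) a y' * h y' x) =
    fun x => c' + \sum_(y' <- undup ys) a' y' * h y' x].
  by exists c, a.
exists c1, (a y :: cs); split=> //=.
- by rewrite scs.
- by move=> c'; rewrite inE => /predU1P[->//|/Fcs].
apply/funext => x; rewrite (negbTE yys) !big_cons /= addrCA.
by have := congr1 (fun f => f x) e => /= ->; rewrite addrCA.
Qed.

(** Linear independence modulo constant functions, because every sum also has a free constant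
    term. *)
Definition affinely_independent := forall (S : seq Y) (c : K) (a : Y -> K),
  uniq S -> (forall x, c + \sum_(y <- S) a y * h y x = 0) ->
  forall y, y \in S -> a y = 0.

(** Give every monomial of [ys] the same nonzero coefficient. The resulting function is also a
    combination of [zs], so a monomial missing from [zs] would have coefficient zero. *)
Lemma combinations_sub ys zs : affinely_independent ->
  combinations ys `<=` combinations zs -> {subset ys <= zs}.
Proof.
move=> indep yszs y yys; have [_ [a Fa a0]] := hF.
have /yszs/combinations_undup[c [b [Fc Fb e]]] : combinations ys
    (fun x => a + \sum_(y <- undup ys) a * h y x).
  by apply/combinations_undup; exists a, (fun=> a).
apply/negPn/negP => yzs; move/eqP: a0; apply.
(* The right-hand side is the coefficient of [y] in the difference of the two combinations; the
   indicators let both be summed over the common support [S]. *)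
have {1}-> : a = a * (y \in ys)%:R - b y * (y \in zs)%:R.
  by rewrite yys (negbTE yzs) mulr1 mulr0 subr0.
pose S := undup (ys ++ zs).
have sumS (d : Y -> K) (rs : seq Y) x : {subset rs <= ys ++ zs} ->
    \sum_(y <- S) d y * (y \in rs)%:R * h y x = \sum_(y <- undup rs) d y * h y x.
  move=> rsS; rewrite (bigID (mem rs)) /= [X in _ + X]big1 ?addr0; last first.
    by move=> z /negbTE ->; rewrite mulr0 mul0r.
  rewrite -big_filter (perm_big (undup rs)) /=; last first.
    apply: uniq_perm; rewrite ?filter_uniq ?undup_uniq// => z.
    by rewrite mem_filter !mem_undup /=; case: (boolP (z \in rs)) => // /rsS ->.
  by rewrite big_seq [RHS]big_seq; apply: eq_bigr => z; rewrite mem_undup => ->;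
    rewrite mulr1.
apply: (indep S (a - c) (fun y => a * (y \in ys)%:R - b y * (y \in zs)%:R)).
- exact: undup_uniq.
- move=> x; under eq_bigr do rewrite mulrBl.
  rewrite sumrB !sumS; last 2 first.
    by move=> z; rewrite mem_cat orbC => ->.
    by move=> z; rewrite mem_cat => ->.
  rewrite addrACA -opprD; apply/eqP; rewrite subr_eq0; apply/eqP.
  exact: (congr1 (fun f => f x) e).
- by rewrite mem_undup mem_cat yys.
Qed.

Lemma eq_combinations ys zs : affinely_independent ->
  combinations ys = combinations zs <-> ys =i zs.
Proof.
move=> indep; split=> [e y|e].
  by apply/idP/idP; apply: combinations_sub => //; rewrite e.
apply/seteqP; split=> f /combinations_undup[c [a [Fc Fa ->]]];
  apply/combinations_undup; exists c, a; split=> //; apply/funext => x;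
  congr (_ + _); apply: perm_big; apply: uniq_perm; rewrite ?undup_uniq// => y;
  by rewrite !mem_undup e.
Qed.

End Combinations.

(** * The functions denoted by a sum of monomials *)

Section SumStringFun.
Variables (K : fieldType) (X : choiceType).

Lemma eval_sum_string (x : X -> K) (us : seq (seq X)) c cs :
  size cs = size us ->
  eval_from 1 (substitute x (sum_string us) (c :: cs)) =
  c + \sum_(uc <- zip us cs) uc.2 * \prod_(i <- uc.1) x i.
Proof.
rewrite /sum_string /= mul1r; set f := fun _ => _.
elim: us c cs => [|u us IH] c [|b cs]//=; first by rewrite big_nil addr0.
move=> [scs]; rewrite big_cons /= mul1r; congr (_ + _).
elim: u b => [|i u IHu] b /=; first by rewrite big_nil mulr1 IH.
by rewrite IHu big_cons mulrA.
Qed.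

Lemma count_Const_sum_string (us : seq (seq X)) :
  count_mem Const (sum_string us) = (size us).+1.
Proof.
rewrite /sum_string /= add1n; congr _.+1.
elim: us => //= u us IH; rewrite add1n count_cat IH.
by rewrite (_ : count _ _ = 0%N) //; elim: u.
Qed.

Variables (D F : set K) (U Y : choiceType) (str : U -> seq X) (mo : U -> Y).
Variable h : Y -> (X -> D) -> K.
Hypothesis hF : free_constants F.
Hypothesis prod_str : forall u x, \prod_(i <- str u) val (x i) = h (mo u) x.

(** Commutativity enters here: a word matters only through its monomial [mo u], whose value is
    [h (mo u)]. *)
Lemma Phi_sum_string (us : seq U) :
  Phi D F (sum_string (map str us)) = combinations h F (map mo us).
Proof.
have sumE cs x : size cs = size us ->
    \sum_(uc <- zip (map str us) cs) uc.2 * \prod_(i <- uc.1) val (x i) =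
    \sum_(yc <- zip (map mo us) cs) yc.2 * h yc.1 x :> K.
  elim: us cs => [|u us IH] [|c cs] //=; first by rewrite !big_nil.
  by move=> [/IH e]; rewrite !big_cons e /= prod_str.
apply/seteqP; split=> f /=.
- case=> -[[|c cs] scs] Fcs <-.
    by have := etrans (eqP scs) (count_Const_sum_string _).
  have scs' : size cs = size us.
    have := etrans (eqP scs) (count_Const_sum_string _).
    by rewrite size_map => -[].
  have Fcs' c' : c' \in c :: cs -> F c'.
    move=> /(nthP 0)[i]; rewrite (eqP scs) => ilt <-.
    by have := Fcs (Ordinal ilt); rewrite (tnth_nth 0).
  exists c, cs; split.
  - by apply: Fcs'; rewrite mem_head.
  - by rewrite size_map.
  - by move=> c' cs'; apply: Fcs'; rewrite inE cs' orbT.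
  - by apply/funext => x; rewrite /expr_fun eval_sum_string ?size_map// sumE.
- move=> [c [cs [Fc]]]; rewrite size_map => scs Fcs ->.
  have sc : size (c :: cs) == count_mem Const (sum_string (map str us)).
    by rewrite count_Const_sum_string size_map /= scs.
  exists (Tuple sc); last first.
    by apply/funext => x; rewrite /expr_fun eval_sum_string ?size_map// sumE.
  move=> i; rewrite (tnth_nth 0) /=.
  have : nth 0 (c :: cs) i \in c :: cs by rewrite mem_nth// (eqP sc).
  by rewrite inE => /predU1P[->//|/Fcs].
Qed.

Lemma expr_equiv_sum_string (us vs : seq U) : affinely_independent h ->
  expr_equiv D F (sum_string (map str us)) (sum_string (map str vs)) <->
  map mo us =i map mo vs.
Proof.
by move=> ?; rewrite /expr_equiv !Phi_sum_string; exact: eq_combinations.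
Qed.

End SumStringFun.

(** * Independence of monomials and of variables over an infinite set *)

Section Independence.
Import finmap.
Variables (K : fieldType) (D : set K).
Hypothesis hD : infinite_set D.

Lemma poly_eq0_on_infinite (P : {poly K}) :
  (forall d, D d -> P.[d] = 0) -> P = 0.
Proof.
move=> P0; apply/eqP/negPn/negP => Pn0.
have [B BD] := infinite_set_fset (size P) hD.
rewrite leqNgt; have -> // := max_poly_roots Pn0 _ (fset_uniq B).
by apply/allP => d dB; apply/rootP/P0/BD.
Qed.

(* One variable at a time: after r steps, only the monomials agreeing with m0
   on the first r variables are left in the sum, and these variables are gone. *)
Lemma prod_exp_independent (n : nat) (S : seq {ffun 'I_n -> nat})
    (a : {ffun 'I_n -> nat} -> K) : uniq S ->
  (forall x : 'I_n -> D, \sum_(m <- S) a m * \prod_i val (x i) ^+ m i = 0) ->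
  forall m, m \in S -> a m = 0.
Proof.
move=> uS a0 m0 m0S.
pose agree r (m : {ffun 'I_n -> nat}) :=
  [forall i : 'I_n, (i < r)%N ==> (m i == m0 i)].
have [d0 Dd0] : D !=set0.
  by apply/set0P/eqP => D0; apply: hD; rewrite D0; exact: finite_set0.
have main r : (r <= n)%N -> forall x : 'I_n -> D,
    \sum_(m <- S | agree r m) a m * \prod_(i < n | (r <= i)%N) val (x i) ^+ m i = 0.
  elim: r => [|r IH] rn x.
    rewrite -[RHS](a0 x); apply: eq_big => // m; exact/forallP.
  pose i0 := Ordinal rn.
  (* The sum as a polynomial in variable number r alone. It vanishes on D, hence is zero, and its
     coefficient of degree [m0 i0] keeps just the monomials agreeing with [m0] in this variable
     too. *)
  pose P : {poly K} := \sum_(m <- S | agree r m)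
    (a m * \prod_(i < n | (r < i)%N) val (x i) ^+ m i) *: 'X^(m i0).
  have P0 : P = 0.
    apply: poly_eq0_on_infinite => d Dd.
    pose x' i : D := if i == i0 then exist _ d (mem_set Dd) else x i.
    rewrite -[RHS](IH (ltnW rn) x') horner_sum; apply: eq_bigr => m _.
    rewrite hornerZ hornerXn -mulrA; congr (_ * _).
    rewrite [RHS](bigD1 i0)//= {1}/x' eqxx mulrC; congr (_ * _).
    apply: eq_big => [i|i ri]; first by rewrite ltn_neqAle andbC eq_sym.
    by rewrite /x'; case: eqP ri => // ->; rewrite ltnn.
  have := congr1 (fun P : {poly K} => P`_(m0 i0)) P0.
  rewrite coef0 coef_sum => P0i; rewrite -[RHS]P0i.
  rewrite [RHS](bigID (agree r.+1)) /= [X in _ = _ + X]big1 ?addr0.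
    apply: eq_big => m.
      apply/idP/andP => [/forallP ag|[]//]; split; last exact/forallP.
      by apply/forallP => i; apply/implyP => ir; apply: (implyP (ag i)); rewrite ltnW.
    move=> /forallP/(_ i0); rewrite /= ltnSn => /eqP e.
    by rewrite coefZ coefXn e eqxx mulr1.
  move=> m /andP[/forallP ag nag]; rewrite coefZ coefXn.
  case: eqP => [e|]; last by rewrite mulr0.
  case/negP: nag; apply/forallP => i; apply/implyP; rewrite ltnS leq_eqVlt.
  case/predU1P => [ei|ir]; last exact: (implyP (ag i)).
  by rewrite (_ : i = i0) ?e//; exact: val_inj.
have := main n (leqnn n) (fun=> exist _ d0 (mem_set Dd0)).
rewrite big_mkcond (bigD1_seq m0) //= ifT; last first.
  by apply/forallP => i; apply/implyP.
rewrite big_pred0 ?mulr1; last by move=> i; rewrite leqNgt ltn_ord.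
rewrite big1 ?addr0// => m mm0; rewrite ifF//; apply/negP => /forallP ag.
case/negP: mm0; apply/eqP/ffunP => i.
by apply/eqP; apply: (implyP (ag i)).
Qed.

Definition monomial_fun n (m : monomial n) (x : 'I_n -> D) : K :=
  \prod_i val (x i) ^+ val m i.

(** The constant c is the coefficient of the zero exponent vector [z], which has degree 0 and so is
    none of the monomials in [S]. *)
Lemma monomial_fun_independent n : affinely_independent (@monomial_fun n).
Proof.
move=> S c a uS e m mS.
pose a' (m : {ffun 'I_n -> nat}) := if insub m is Some m' then a m' else c.
have a'E (m' : monomial n) : a' (val m') = a m' by rewrite /a' valK.
pose z : {ffun 'I_n -> nat} := [ffun=> 0%N].
have z0 : (0 < \sum_i z i)%N = false by rewrite big1// => i _; rewrite ffunE.
rewrite -a'E; apply: (@prod_exp_independent n (z :: map val S)).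
- rewrite /= map_inj_uniq ?uS ?andbT; last exact: val_inj.
  by apply/negP => /mapP[m' _ e']; have := z0; rewrite e' (valP m').
- move=> x; rewrite big_cons big_map /= -[RHS](e x); congr (_ + _).
    by rewrite /a' insubF ?z0// big1 ?mulr1// => i _; rewrite ffunE.
  by apply: eq_bigr => m' _; rewrite a'E.
- by rewrite inE map_f// orbT.
Qed.

(** Compare two points that differ only in the variable [y], with values d0 and d1 there: the
    difference of the relations is a y (d1 - d0) = 0. *)
Lemma variable_fun_independent (Y : choiceType) :
  affinely_independent (fun (y : Y) (x : Y -> D) => val (x y) : K).
Proof.
move=> S c a uS e y yS.
have [B BD] := infinite_set_fset 2 hD.
have {}BD d : d \in (B : seq K) -> D d by exact: BD.
case: (B : seq K) (fset_uniq B) BD => [|d0 [|d1 s]]//= => /andP[].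
rewrite inE negb_or => /andP[d01 _] _ BD _.
have D0 : D d0 by apply: BD; rewrite mem_head.
have D1 : D d1 by apply: BD; rewrite !inE eqxx orbT.
have := e (fun y' => if y' == y then exist _ d1 (mem_set D1)
  else exist _ d0 (mem_set D0)).
rewrite -[RHS](e (fun=> exist _ d0 (mem_set D0))).
rewrite !(bigD1_seq y)//= eqxx => /addrI.
under eq_bigr => y' /negbTE yy' do rewrite yy'.
move=> /addIr/esym/eqP; rewrite -subr_eq0 -mulrBr mulf_eq0 subr_eq0 => /predU1P[//|].
by rewrite (negbTE d01).
Qed.

End Independence.

Lemma prod_count (K : comPzRingType) (n : nat) (x : 'I_n -> K) (u : seq 'I_n) :
  \prod_(i <- u) x i = \prod_i x i ^+ count_mem i u.
Proof.
elim: u => [|j u IH]; first by rewrite big_nil big1.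
rewrite big_cons IH /= [RHS](bigD1 j)//= eqxx exprS -mulrA [in LHS](bigD1 j)//=.
do 2!congr (_ * _); apply: eq_bigr => i ij.
by rewrite eq_sym (negbTE ij).
Qed.

(** * Words over a finite alphabet *)

Lemma esum_seq (R : realType) (T : choiceType) (s : seq T) (f : T -> R) :
  uniq s -> (forall x, 0 <= f x) ->
  (\esum_(x in [set` s]) (f x)%:E = (\sum_(x <- s) f x)%:E)%E.
Proof.
move=> us f0; rewrite esum_fset; first last.
- by move=> x _; rewrite lee_fin.
- exact: finite_seq.
by rewrite -sumEFin; apply/esym/fsbig_seq.
Qed.

Lemma esum_finType (R : realType) (X : finType) (f : X -> R) :
  (forall x, 0 <= f x) -> (\esum_(x in setT) (f x)%:E = (\sum_x f x)%:E)%E.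
Proof.
move=> f0; rewrite (_ : setT = [set` enum X]).
  by rewrite esum_seq ?enum_uniq// big_enum.
by apply/seteqP; split=> x //= _; rewrite mem_enum.
Qed.

Section Words.
Variable X : finType.

Fixpoint words (M : nat) : seq (seq X) :=
  if M is M'.+1 then [seq x :: u | x <- enum X, u <- words M'] else [:: [::]].

Lemma mem_words M u : (u \in words M) = (size u == M).
Proof.
elim: M u => [|M IH] [|x u]; rewrite ?inE//=.
  by apply/allpairsP => -[] /= ? [].
apply/allpairsP/eqP => [[[y v] /= [_ vM [_ ->]]]|[uM]].
  by move: vM; rewrite IH => /eqP ->.
by exists (x, u); split; rewrite ?mem_enum// IH uM.
Qed.

Lemma words_uniq M : uniq (words M).
Proof.
elim: M => // M IH; apply: allpairs_uniq => //; first exact: enum_uniq.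
by move=> [x u] [y v] _ _ /= [-> ->].
Qed.

Lemma big_wordsS (R : Type) (idx : R) (op : Monoid.com_law idx) M
    (f : seq X -> R) :
  \big[op/idx]_(u <- words M.+1) f u =
  \big[op/idx]_(x : X) \big[op/idx]_(u <- words M) f (x :: u).
Proof. by rewrite /= big_allpairs_dep /= big_enum. Qed.

Lemma sum_words_prod (R : comPzRingType) (a : X -> R) M :
  \sum_(u <- words M) \prod_(x <- u) a x = (\sum_x a x) ^+ M.
Proof.
elim: M => [|M IH]; first by rewrite big_seq1 big_nil.
rewrite big_wordsS exprS -IH mulr_suml; apply: eq_bigr => x _.
by rewrite mulr_sumr; apply: eq_bigr => u _; rewrite big_cons.
Qed.

(** Words are partitioned by length, and nonnegative terms may be summed block by block. *)
Lemma esum_words (R : realType) (P : set (seq X)) (f : seq X -> R) :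
  (forall u, 0 <= f u) ->
  (\esum_(u in P) (f u)%:E =
   \sum_(0 <= M <oo) (\sum_(u <- words M | u \in P) f u)%:E)%E.
Proof.
move=> f0; rewrite esum_mkcond.
have -> : [set: seq X] = \bigcup_M [set` words M].
  by apply/seteqP; split=> // u _; exists (size u) => //=; rewrite mem_words.
rewrite nneseries_sum_bigcup.
- apply: eq_eseriesr => M _.
  under eq_esum do rewrite -(fun_if EFin).
  rewrite esum_seq ?words_uniq -?big_mkcond// => u.
  by case: ifP.
- apply/trivIsetP => i j _ _ ij; apply/seteqP; split=> // u [] /=.
  by rewrite !mem_words => /eqP ui /eqP uj; rewrite -ui -uj eqxx in ij.
- by move=> u; case: ifP => // _; rewrite lee_fin.
Qed.

(* Inclusion-exclusion over the set I of letters that do not occur. *)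
Lemma sum_words_surj (R : comPzRingType) (a : X -> R) M :
  \sum_(u <- words M | [forall x, x \in u]) \prod_(x <- u) a x =
  \sum_(I : {set X}) (-1) ^+ #|I| * (\sum_(x in ~: I) a x) ^+ M.
Proof.
(* Expand the product over all letters x of 1 - [x not in u]. The term of I factors over the
   positions of [u], so it can be merged with the weights. *)
have surjE (u : seq X) : [forall x, x \in u]%:R =
    \sum_(I : {set X}) (-1) ^+ #|I| * \prod_(x <- u) (x \notin I)%:R :> R.
  have -> : [forall x, x \in u]%:R = \prod_x (- (x \notin u)%:R + 1) :> R.
    have [/forallP xu|/forallPn[x xu]] := boolP [forall x, x \in u].
      by rewrite big1// => x _; rewrite xu oppr0 add0r.
    by rewrite (bigD1 x)//= xu addNr mul0r.
  rewrite bigA_distr; apply: eq_bigr => I _.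
  rewrite -big_mkcond /= prodrN; congr (_ * _).
  have -> : \prod_(x <- u) (x \notin I)%:R = (all [predC I] u)%:R :> R.
    elim: u => [|x u IH]; first by rewrite big_nil.
    by rewrite big_cons IH -natrM mulnb.
  have [/allP uI|/allPn[x xu /negPn xI]] := boolP (all _ u).
    rewrite big1// => x xI; case: (boolP (x \in u)) => // /uI.
    by rewrite inE xI.
  by rewrite (bigD1 x)//= xu mul0r.
rewrite big_mkcond /=.
transitivity (\sum_(u <- words M) \sum_(I : {set X})
    (-1) ^+ #|I| * \prod_(x <- u) (a x * (x \notin I)%:R)).
  apply: eq_bigr => u _; under [RHS]eq_bigr do rewrite big_split /= mulrCA.
  rewrite -mulr_sumr -surjE.
  by case: ifP => _; rewrite ?mulr1 ?mulr0.
rewrite exchange_big; apply: eq_bigr => I _; rewrite -mulr_sumr sum_words_prod.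
congr (_ * _ ^+ _); rewrite [RHS]big_mkcond; apply: eq_bigr => x _.
by rewrite inE; case: (x \in I); rewrite ?mulr0 ?mulr1.
Qed.

End Words.

(** * Geometric series and words using every letter *)

Section Geometric.
Import numFieldNormedType.Exports.
Variable R : realType.

Lemma geometric_series_cvg (p s : R) :
  0 <= p <= 1 -> 0 <= s <= 1 ->
  series (geometric (1 - p) (p * s)) @ \oo --> (1 - p) / (1 - p * s).
Proof.
move=> /andP[p0 p1] /andP[s0 s1].
have [ps1|ps1] := ltP (p * s) 1.
  by apply: cvg_geometric_series; rewrite ger0_norm ?mulr_ge0.
(* In the degenerate case p s = 1, the series vanishes identically and so does the numerator 1 - p,
   whatever the denominator. *)
have -> : p = 1.
  by apply/eqP; rewrite eq_le p1 (le_trans ps1)// -[leRHS]mulr1 ler_wpM2l.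
rewrite subrr mul0r; have -> : series (geometric 0 (1 * s)) = (fun=> 0).
  apply/funext => n; rewrite seriesEord /= big1// => i _.
  by rewrite mul0r.
exact: cvg_cst.
Qed.

Lemma nneseries_cvg (b : nat -> R) l :
  series b @ \oo --> l -> (\sum_(0 <= i <oo) (b i)%:E = l%:E)%E.
Proof.
move=> bl; have := @EFin_lim _ (series b) (cvgP _ bl).
rewrite (cvg_lim _ bl)// => <-.
by apply: congr_lim; apply/funext => n; rewrite /= sumEFin.
Qed.

(** Inclusion-exclusion is applied at each length. As it produces signs, the limit is taken on real
    partial sums, where the finite sum over I is exchanged with the sum over lengths. *)
Lemma esum_surj_words (X : finType) (p : R) (a : X -> R) :
  0 <= p <= 1 -> (forall x, 0 <= a x) -> \sum_x a x <= 1 ->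
  (\esum_(u in [set u : seq X | forall x, x \in u])
     ((1 - p) * p ^+ size u * \prod_(x <- u) a x)%:E =
   (\sum_(I : {set X})
      (-1) ^+ #|I| * ((1 - p) / (1 - p * \sum_(x in ~: I) a x)))%:E)%E.
Proof.
move=> p01 a0 a1; have /andP[p0 p1] := p01.
rewrite esum_words; last first.
  by move=> u; rewrite !mulr_ge0 ?exprn_ge0 ?subr_ge0// prodr_ge0.
apply: nneseries_cvg.
rewrite (_ : series _ = fun n => \sum_(I : {set X}) (-1) ^+ #|I| *
    series (geometric (1 - p) (p * \sum_(x in ~: I) a x)) n); last first.
  apply/funext => n; rewrite seriesEord /=.
  under [RHS]eq_bigr do rewrite seriesEord mulr_sumr.
  rewrite exchange_big; apply: eq_bigr => M _ /=.
  transitivity ((1 - p) * p ^+ M *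
      \sum_(u <- words X M | [forall x, x \in u]) \prod_(x <- u) a x).
    rewrite mulr_sumr big_seq_cond [RHS]big_seq_cond; apply: eq_big => u.
      by congr (_ && _); apply/idP/forallP => [/set_mem|xu]; last exact/mem_set.
    by rewrite mem_words => /andP[/eqP -> _].
  rewrite sum_words_surj mulr_sumr; apply: eq_bigr => I _.
  by rewrite exprMn mulrCA !mulrA.
apply: cvg_big => [|I _]; first exact: add_continuous.
apply: cvgMl_tmp; apply: geometric_series_cvg => //.
rewrite sumr_ge0//= (le_trans _ a1)// [leRHS](bigID (mem (~: I)))/=.
by rewrite lerDl sumr_ge0.
Qed.

End Geometric.

(** The multinomial coefficient in division-free form. In the induction, the words of length M + 1
    starting with j contribute m_j M!, and the m_j add up to M + 1. *)
Lemma sum_words_count (R : comPzRingType) (n M : nat) (m : 'I_n -> nat) :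
  (\sum_i m i = M)%N ->
  \sum_(u <- words 'I_n M | [forall i, count_mem i u == m i])
    \prod_i (m i)`!%:R = M`!%:R :> R.
Proof.
elim: M m => [|M IH] m mM.
  have m0 i : m i = 0%N.
    by apply/eqP; rewrite -leqn0 -mM (bigD1 i)//= leq_addr.
  rewrite big_mkcond big_seq1 ifT; last by apply/forallP => i; rewrite m0.
  by rewrite big1// => i _; rewrite m0.
rewrite big_mkcond big_wordsS factS natrM -mM natr_sum mulr_suml.
apply: eq_bigr => j _; case mj : (m j) => [|k].
  rewrite mul0r big1// => u _; rewrite ifF//; apply/negP => /forallP/(_ j).
  by rewrite mj /= eqxx.
pose m' i := if i == j then k else m i.
have m'M : (\sum_i m' i = M)%N.
  move: mM; rewrite (bigD1 j)//= mj addSn => -[<-].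
  rewrite (bigD1 j)//= {1}/m' eqxx; congr addn; apply: eq_bigr => i /negbTE ij.
  by rewrite /m' ij.
rewrite -(IH m' m'M) mulr_sumr [RHS]big_mkcond; apply: eq_bigr => u _.
have -> : [forall i, count_mem i (j :: u) == m i] =
    [forall i, count_mem i u == m' i].
  apply: eq_forallb => i; rewrite /= /m' [j == i]eq_sym.
  by have [->|] := eqVneq i j; rewrite ?mj.
case: ifP => // _; rewrite (bigD1 j)//= mj factS natrM -mulrA; congr (_ * _).
rewrite [RHS](bigD1 j)//= /m' eqxx; congr (_ * _).
by apply: eq_bigr => i /negbTE ->.
Qed.

(** * Grouping words by monomials *)

Section EsumExtra.
Variable R : realType.

Lemma le_esumZl (T : choiceType) (A : set T) (c : R) (f : T -> R) :
  0 <= c -> (forall t, 0 <= f t) ->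
  (\esum_(t in A) (c * f t)%:E <= c%:E * \esum_(t in A) (f t)%:E)%E.
Proof.
move=> c0 f0; apply: ge_ereal_sup => _ [X [finX XA] <-].
under eq_fsbigr do rewrite EFinM.
rewrite -ge0_mule_fsumr; last by move=> t; rewrite lee_fin.
apply: lee_wpmul2l; first by rewrite lee_fin.
by apply: ereal_sup_ubound; exists X.
Qed.

(** For c > 0 the converse inequality is [le_esumZl] with the factor 1/c and the function c f. *)
Lemma esumZl (T : choiceType) (A : set T) (c : R) (f : T -> R) :
  0 <= c -> (forall t, 0 <= f t) ->
  (\esum_(t in A) (c * f t)%:E = c%:E * \esum_(t in A) (f t)%:E)%E.
Proof.
move=> c0 f0; have [->|cn0] := eqVneq c 0.
  by rewrite mul0e esum1// => t _; rewrite mul0r.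
have c1 : 0 < c by rewrite lt_neqAle eq_sym cn0.
apply/eqP; rewrite eq_le le_esumZl//=.
rewrite -lee_pdivlMl//; apply: le_trans; last first.
  by apply: le_esumZl => //; [rewrite invr_ge0|move=> t; rewrite mulr_ge0].
by apply: le_esum => t _; rewrite mulKf.
Qed.

Lemma esum_fiber (S T : choiceType) (g : S -> T) (Q : set T) (f : S -> \bar R) :
  (forall s, 0 <= f s)%E ->
  (\esum_(s in [set s | Q (g s)]) f s =
   \esum_(t in Q) \esum_(s in [set s | g s = t]) f s)%E.
Proof.
move=> f0; rewrite esum_esum//; apply: reindex_esum; split.
- by move=> [t s] /= [Qt ->].
- by move=> [t s] [t' s'] /set_mem/= [_ <-] /set_mem/= [_ <-] ->.
- by move=> s Qs; exists (g s, s).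
Qed.

End EsumExtra.

Section Grouping.
Variables (R : realType) (U Y : choiceType) (mo : U -> Y).
Variables (wt : U -> R) (pi : Y -> R).
Hypotheses (wt_ge0 : forall u, 0 <= wt u) (pi_ge0 : forall y, 0 <= pi y).
Hypothesis esum_wt :
  forall y, (\esum_(u in [set u | mo u = y]) (wt u)%:E = (pi y)%:E)%E.

(** The words for the successive monomials are chosen independently, so the sum factors. *)
Lemma esum_prod_fiber (ys : seq Y) :
  (\esum_(us in [set us | map mo us = ys]) (\prod_(u <- us) wt u)%:E =
   (\prod_(y <- ys) pi y)%:E)%E.
Proof.
elim: ys => [|y ys IH].
  rewrite (_ : [set _ | _] = [set [::]]) ?esum_set1 ?big_nil ?lee_fin//.
  by apply/seteqP; split=> [[]|us ->].
rewrite (@reindex_esum _ _ _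
  ([set u | mo u = y] `*`` (fun=> [set us | map mo us = ys])) _
  (fun k => k.1 :: k.2)); last first.
  split.
  - by move=> [u us] /= [-> ->].
  - by move=> [u us] [v vs] _ _ [-> ->].
  - by move=> [|u us] //= [uy usys]; exists (u, us).
under eq_esum do rewrite big_cons.
rewrite -(@esum_esum _ _ _ _ _ (fun u us => (wt u * \prod_(v <- us) wt v)%:E)).
  under eq_esum => u _.
    rewrite esumZl//; last by move=> us; exact: prodr_ge0.
    rewrite IH muleC -EFinM; over.
  rewrite esumZl//; last exact: prodr_ge0.
  by rewrite esum_wt big_cons -EFinM mulrC.
by move=> u us _ _; rewrite lee_fin mulr_ge0// prodr_ge0.
Qed.

(** The passage from the polynomial to the linear grammar: all derivations of a monomial collapse
    into one letter of weight [pi], and the number of summands is unchanged. *)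
Lemma esum_prod_group (Q : set (seq Y)) (c : nat -> R) : (forall k, 0 <= c k) ->
  (\esum_(us in [set us | Q (map mo us)])
     (c (size us) * \prod_(u <- us) wt u)%:E =
   \esum_(ys in Q) (c (size ys) * \prod_(y <- ys) pi y)%:E)%E.
Proof.
move=> c0.
rewrite (@esum_fiber _ _ _ (map mo)); last first.
  by move=> us; rewrite lee_fin mulr_ge0// prodr_ge0.
apply: eq_esum => ys _.
rewrite EFinM -esum_prod_fiber -esumZl//; last by move=> us; exact: prodr_ge0.
by apply: eq_esum => us /= <-; rewrite size_map.
Qed.

End Grouping.

(** * Nonempty words and the monomials they spell *)

Section NonemptyWords.
Variable n : nat.

Definition nonempty_word : choiceType := {u : seq 'I_n | (0 < size u)%N}.

Lemma sum_count_mem (u : seq 'I_n) : (\sum_i count_mem i u = size u)%N.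
Proof.
elim: u => [|j u IH]; first by rewrite big1.
rewrite /= big_split /= IH (bigD1 j)//= eqxx big1 ?add1n// => i ij.
by rewrite eq_sym (negbTE ij).
Qed.

Lemma counts_subproof (u : nonempty_word) :
  (0 < \sum_i [ffun i => count_mem i (val u)] i)%N.
Proof. by under eq_bigr do rewrite ffunE; rewrite sum_count_mem (valP u). Qed.

Definition counts (u : nonempty_word) : monomial n :=
  exist _ [ffun i => count_mem i (val u)] (counts_subproof u).

Lemma counts_spells (u : nonempty_word) (m : monomial n) :
  counts u = m <-> spells (val u) m.
Proof.
split=> [<- i|um]; first by rewrite /= ffunE.
by apply/val_inj/ffunP => i; rewrite /= ffunE um.
Qed.

Lemma spells_size (u : seq 'I_n) (m : monomial n) :
  spells u m -> size u = (\sum_i val m i)%N.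
Proof.
by move=> um; rewrite -sum_count_mem; apply: eq_bigr => i _; exact: um.
Qed.

Lemma spells_nonempty (u : seq 'I_n) (m : monomial n) :
  spells u m -> (0 < size u)%N.
Proof. by move=> /spells_size ->; exact: svalP m. Qed.

End NonemptyWords.

(** * The polynomial grammar *)

Section PolynomialGrammar.
Import numFieldNormedType.Exports.
Variables (R : realType) (n : nat) (p q : R) (qs : 'I_n -> R).
Let G := polynomial_grammar p q qs.
Hypothesis hG : is_pcfg G.

Definition factor_tree (i : 'I_n) : parse_tree G :=
  @Node _ _ _ G (PF_var i) [:: Leaf (Var i)].

Definition mul_tree (t : parse_tree G) (i : 'I_n) : parse_tree G :=
  @Node _ _ _ G PV_mul [:: t; factor_tree i].

(** As V is left recursive, the first letter [i] lies deepest, below the only use of [PV_factor]. *)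
Definition word_tree_from (i : 'I_n) (u : seq 'I_n) : parse_tree G :=
  foldl mul_tree (@Node _ _ _ G PV_factor [:: factor_tree i]) u.

(** The value [Leaf Const] is never reached, since [u] is nonempty. *)
Definition word_tree (u : nonempty_word n) : parse_tree G :=
  if val u is i :: u' then word_tree_from i u' else Leaf Const.

Definition word_prob (u : seq 'I_n) : R :=
  q ^+ (size u).-1 * (1 - q) * \prod_(i <- u) qs i.

Lemma word_treeP i u : [/\ well_formed (word_tree_from i u),
  root_symbol (word_tree_from i u) = inl PV,
  tree_string (word_tree_from i u) = map (@Var _) (i :: u) &
  tree_prob (word_tree_from i u) = word_prob (i :: u)].
Proof.
elim/last_ind: u => [|u j [wf rt st pr]].
  by split=> //; rewrite /word_prob /= big_seq1 !mulr1 mul1r.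
rewrite /word_tree_from foldl_rcons -/(word_tree_from i u); split=> //.
- by split=> /=; rewrite ?rt.
- by rewrite /= st /= map_rcons -cats1.
- rewrite /= pr /word_prob -rcons_cons -cats1 big_cat big_seq1 size_cat /= addn1.
  by rewrite exprS !mulr1 !mulrA.
Qed.

Lemma word_tree_surj (t : parse_tree G) :
  well_formed t -> root_symbol t = inl PV -> exists u, t = word_tree u.
Proof.
have facP (t' : parse_tree G) : well_formed t' -> root_symbol t' = inl PF ->
    exists i, t' = factor_tree i.
  case: t' => [//|[||||i] ts] //= [rs _] _.
  by case: ts rs => [//|[a|//] [|//]] [->]; exists i.
move=> wf rt; suff [i [u ->]] : exists i u, t = word_tree_from i u.
  by exists (exist _ (i :: u) isT).
move: t wf rt; fix IH 1 => -[//|[||||i] ts] //= [rs wfs] _.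
- case: ts rs wfs => [//|t1 [//|t2 [|//]]] /= [r1 r2] [w1 [w2 _]].
  have [i [u ->]] := IH t1 w1 r1; have [j ->] := facP t2 w2 r2.
  by exists i, (rcons u j); rewrite /word_tree_from foldl_rcons.
- case: ts rs wfs => [//|t1 [|//]] /= [r1] [w1 _].
  by have [i ->] := facP t1 w1 r1; exists i, [::].
Qed.

Lemma word_tree_wf u : well_formed (word_tree u).
Proof. by case: u => -[//|i u] ?; have [] := word_treeP i u. Qed.

Lemma word_tree_root u : root_symbol (word_tree u) = inl PV.
Proof. by case: u => -[//|i u] ?; have [] := word_treeP i u. Qed.

Lemma word_tree_string u : tree_string (word_tree u) = map (@Var _) (val u).
Proof. by case: u => -[//|i u] ?; have [] := word_treeP i u. Qed.

Lemma word_tree_prob u : tree_prob (word_tree u) = word_prob (val u).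
Proof. by case: u => -[//|i u] ?; have [] := word_treeP i u. Qed.

Let p01 : 0 <= p <= 1. Proof. exact: (hG.1 PE_sum). Qed.
Let q01 : 0 <= q <= 1. Proof. exact: (hG.1 PV_mul). Qed.
Let qs_ge0 i : 0 <= qs i. Proof. by case/andP: (hG.1 (PF_var i)). Qed.

Lemma sum_qs : \sum_i qs i = 1.
Proof.
have := hG.2 PF.
rewrite (@reindex_esum _ _ _ setT _ (@PF_var n)) /=.
  by rewrite esum_finType// => -[].
by split=> [//|i j _ _ []//|[]//= i _]; exists i.
Qed.

Lemma word_prob_ge0 u : 0 <= word_prob u.
Proof.
have /andP[q0 q1] := q01.
by rewrite !mulr_ge0 ?exprn_ge0 ?subr_ge0// prodr_ge0.
Qed.

Lemma monomial_prob_ge0 m : 0 <= monomial_prob q qs m.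
Proof.
have /andP[q0 q1] := q01; rewrite /monomial_prob.
rewrite !mulr_ge0 ?invr_ge0 ?prodr_ge0 ?exprn_ge0 ?subr_ge0// => i _.
by rewrite exprn_ge0.
Qed.

Lemma esum_word_prob_spells (m : monomial n) :
  (\esum_(u in [set u : seq 'I_n | spells u m]) (word_prob u)%:E =
   (monomial_prob q qs m)%:E)%E.
Proof.
set M := (\sum_i val m i)%N.
rewrite (_ : [set u | _] = [set` [seq u <- words 'I_n M |
    [forall i, count_mem i u == val m i]]]); last first.
  apply/seteqP; split=> u /=; rewrite mem_filter mem_words.
    move=> um; rewrite (spells_size um) eqxx andbT.
    by apply/forallP => i; apply/eqP.
  by case/andP => /forallP um _ i; apply/eqP.
rewrite esum_seq ?filter_uniq ?words_uniq//; last exact: word_prob_ge0.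
rewrite big_filter; congr EFin.
have fact_neq0 : \prod_i (val m i)`!%:R != 0 :> R.
  by apply/prodf_neq0 => i _; rewrite pnatr_eq0 -lt0n fact_gt0.
(* With M! written as a sum over the spellings of [m], the factorials cancel term by term and leave
   the probability of each word. *)
rewrite /monomial_prob -/M -(@sum_words_count R n M (val m))//.
rewrite !mulr_suml big_seq_cond [RHS]big_seq_cond; apply: eq_bigr => u.
rewrite mem_words => /andP[/eqP uM /forallP um].
rewrite /word_prob uM divff// mul1r prod_count; congr (_ * _).
by apply: eq_bigr => i _; rewrite (eqP (um i)).
Qed.

Lemma esum_word_prob_counts (m : monomial n) :
  (\esum_(u in [set u | counts u = m]) (word_prob (val u))%:E =
   (monomial_prob q qs m)%:E)%E.
Proof.
rewrite -esum_word_prob_spells; apply/esym.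
apply: (@reindex_esum _ _ _ _ _ (fun u : nonempty_word n => val u)); split.
- by move=> u /counts_spells.
- by move=> u v _ _; exact: val_inj.
- move=> u /= um; exists (exist _ u (spells_nonempty um)) => //.
  exact/counts_spells.
Qed.

Lemma trees_word u :
  trees (G := G) PV (map (@Var _) (val u)) = [set word_tree u].
Proof.
apply/seteqP; split=> t /=.
  case=> wf /(word_tree_surj wf)[v ->]; rewrite word_tree_string.
  by move=> /map_Var_inj/val_inj ->.
by move=> ->; split; [exact: word_tree_wf|exact: word_tree_root
  |exact: word_tree_string].
Qed.

(** Only variables are counted, so strings containing [Plus] or [Const] are included; they have no
    tree from [PV] and contribute 0. *)
Lemma esum_prob_from_spells (m : monomial n) :
  (\esum_(v in [set v : seq (symbol 'I_n) |
                  forall i, count_mem (Var i) v = val m i]) prob_from G PV v =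
   (monomial_prob q qs m)%:E)%E.
Proof.
pose word_string (u : nonempty_word n) := map (@Var _) (val u).
transitivity (\esum_(v in [set v : seq (symbol 'I_n) |
    forall i, count_mem (Var i) v = val m i] `&` range word_string)
    prob_from G PV v)%E.
  rewrite esum_mkcondr; apply: eq_esum => v _; case: ifPn => // /negP nv.
  rewrite /prob_from (_ : trees _ _ = set0) ?esum_set0//.
  apply/seteqP; split=> // t [wf rt tv]; apply: nv; apply/mem_set.
  have [u tu] := word_tree_surj wf rt; exists u => //.
  by rewrite /word_string -word_tree_string -tu.
rewrite -esum_word_prob_counts.
rewrite (@reindex_esum _ _ _ [set u | counts u = m] _ word_string).
  apply: eq_esum => u _; rewrite /prob_from trees_word esum_set1 ?word_tree_prob//.
  by rewrite lee_fin word_prob_ge0.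
have countVar i u : count_mem (Var i) (word_string u) = count_mem i (val u).
  by rewrite count_map; apply: eq_count => j /=; apply/eqP/eqP => [[]|->].
split.
- move=> u /= /counts_spells um; split; last by exists u.
  by move=> i; rewrite countVar um.
- by move=> u v _ _ /map_Var_inj/val_inj.
- move=> v [vm [u _ uv]]; exists u => //; apply/counts_spells => i.
  by rewrite -countVar uv vm.
Qed.

(** Ungrouped, this is the sum over all nonempty words; those of length M + 1 have total weight q^M
    (1 - q), a geometric series with sum 1. *)
Lemma esum_monomial_prob : q < 1 ->
  (\esum_(m in setT) (monomial_prob q qs m)%:E = 1%:E)%E.
Proof.
move=> q1; have /andP[q0 _] := q01.
under eq_esum do rewrite -esum_word_prob_counts.
rewrite -(@esum_fiber _ _ _ _ setT); last first.
  by move=> u; rewrite lee_fin word_prob_ge0.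
transitivity
    (\esum_(u in [set u : seq 'I_n | (0 < size u)%N]) (word_prob u)%:E)%E.
  apply/esym; apply: (@reindex_esum _ _ _ _ _ (fun u : nonempty_word n => val u)).
  split=> [[u u0] _ //|u v _ _|u /= u0]; first exact: val_inj.
  by exists (exist _ u u0).
rewrite esum_words; last exact: word_prob_ge0.
(* Length 0 contributes nothing, as the empty word is excluded; the shift aligns length M + 1 with
   q^M. *)
apply: nneseries_cvg; rewrite -(cvg_shiftS (series _)).
rewrite (_ : (fun _ => _) = series (geometric (1 - q) q)).
  have := @cvg_geometric_series R (1 - q) q.
  by rewrite ger0_norm// divff ?subr_eq0 ?gt_eqF//; exact.
apply/funext => N; rewrite !seriesEord /= big_ord_recl /= big_mkcond big_seq1.
rewrite ifF ?add0r; last by apply/negP => /set_mem.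
apply: eq_bigr => M _.
rewrite -[LHS]/(\sum_(u <- words _ M.+1 |
  u \in [set u | (0 < size u)%N]) word_prob u).
transitivity (q ^+ M * (1 - q) * \sum_(u <- words 'I_n M.+1) \prod_(i <- u) qs i).
  rewrite mulr_sumr big_seq_cond [RHS]big_seq; apply: eq_big => u.
    rewrite mem_words; case: eqP => // uM; apply/mem_set.
    by rewrite /= uM.
  by rewrite mem_words => /andP[/eqP uM _]; rewrite /word_prob uM.
by rewrite sum_words_prod sum_qs expr1n mulr1 mulrC.
Qed.

(** For q < 1 these are distinct terms of a nonnegative series with sum 1; for q = 1 the factor 1 -
    q makes them all zero. *)
Lemma sum_monomial_prob_le1 k (m : 'I_k -> monomial n) : injective m ->
  \sum_j monomial_prob q qs (m j) <= 1.
Proof.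
move=> minj; have /andP[q0 q1] := q01.
have [q1'|q1'] := ltP q 1; last first.
  have {q1 q1'}-> : q = 1 by apply/eqP; rewrite eq_le q1.
  by rewrite big1// => j _; rewrite /monomial_prob subrr mulr0 mul0r.
rewrite -lee_fin -(esum_monomial_prob q1') -big_enum -(big_map m predT).
rewrite -esum_seq; first last.
- exact: monomial_prob_ge0.
- by rewrite map_inj_uniq ?enum_uniq.
rewrite [X in (X <= _)%E]esum_mkcond; apply: le_esum => y _.
by case: ifP => // _; rewrite lee_fin monomial_prob_ge0.
Qed.

Let L := linear_grammar p (monomial_prob q qs).

Lemma is_pcfg_monomial_grammar : q < 1 -> is_pcfg L.
Proof.
move=> q1; have /andP[p0 p1] := p01; split.
  case=> [||m]; first exact: p01.
    by rewrite /= subr_ge0 p1 lerBlDr lerDl.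
  rewrite /= monomial_prob_ge0.
  (* The bound by 1 for a single rule is the case of one monomial. *)
  have := @sum_monomial_prob_le1 1 (fun=> m); rewrite big_ord1; apply=> i j _.
  by rewrite [i]ord1 [j]ord1.
case.
  rewrite (_ : [set r | _] = [set` [:: LE_sum; LE_const : rule L]]); last first.
    apply/seteqP; split=> [[||m]|r] //=; rewrite ?inE ?eqxx ?orbT//.
    by case/orP => /eqP ->.
  transitivity (\sum_(r <- [:: LE_sum; LE_const : rule L]) @prob _ _ _ L r)%:E.
    rewrite esum_seq//.
      by rewrite /= inE andbT; apply/eqP.
    case=> [||m] //=; rewrite ?subr_ge0//; exact: monomial_prob_ge0.
  by rewrite !big_cons big_nil /= addr0 addrC subrK.
rewrite (@reindex_esum _ _ _ setT _ (@LV_var (monomial n)))/=.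
  exact: esum_monomial_prob.
by split=> [//|i j _ _ []//|[]//= m _]; exists m.
Qed.

(** * Probabilities of expressions in the two grammars *)

Variables (K : fieldType) (D F : set K).
Hypotheses (hD : infinite_set D) (hF : free_constants F).

Lemma expr_prob_polynomial (ws : seq (nonempty_word n)) :
  expr_prob G D F (sum_string (map val ws)) =
  (\esum_(us in [set us | map (@counts n) us =i map (@counts n) ws])
     ((1 - p) * p ^+ size us * \prod_(u <- us) word_prob (val u))%:E)%E.
Proof.
apply: (@expr_prob_sum_string _ _ _ G PV PE_sum PE_const p _ _ _ _ _ _ _ p01
  _ val word_tree (fun u => word_prob (val u))) => //.
- by case; [left|right|..].
- exact: word_tree_wf.
- exact: word_tree_root.
- exact: word_tree_string.
- exact: word_tree_prob.
- exact: word_tree_surj.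
- by move=> u; exact: word_prob_ge0.
move=> us; apply: (expr_equiv_sum_string (h := @monomial_fun K D n)) => //.
  move=> u x; rewrite (prod_count (fun i => val (x i))).
  by apply: eq_bigr => i _; rewrite ffunE.
exact: monomial_fun_independent.
Qed.

(** Each monomial is now a terminal with its own value in D, so independence of single variables
    suffices. *)
Lemma expr_prob_linear (ms : seq (monomial n)) :
  expr_prob L D F (sum_string (map (fun m => [:: m]) ms)) =
  (\esum_(ms' in [set ms' : seq (monomial n) | ms' =i ms])
     ((1 - p) * p ^+ size ms' * \prod_(m <- ms') monomial_prob q qs m)%:E)%E.
Proof.
transitivity (\esum_(ms' in
     [set ms' : seq (monomial n) | map id ms' =i map id ms])
     ((1 - p) * p ^+ size ms' * \prod_(m <- ms') monomial_prob q qs m)%:E)%E;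
  last by under eq_set do rewrite !map_id.
apply: (@expr_prob_sum_string _ _ _ L LV LE_sum LE_const p _ _ _ _ _ _ _ p01
  _ (fun m => [:: m]) (fun m => @Node _ _ _ L (LV_var m) [:: Leaf (Var m)])
  (monomial_prob q qs)) => //.
- by case; [left|right|..].
- by move=> m m' [].
- by move=> m; rewrite /= !mulr1.
- case=> [//|[||m] ts] //= [rs _] _.
  by case: ts rs => [//|[a|//] [|//]] [->]; exists m.
- exact: monomial_prob_ge0.
move=> us; apply: (expr_equiv_sum_string
    (h := fun (m : monomial n) (x : monomial n -> D) => val (x m))) => //.
  by move=> m x; rewrite big_seq1.
exact: variable_fun_independent.
Qed.

End PolynomialGrammar.

Theorem mainTheorem3 (R : realType) (n : nat) (p q : R) (qs : 'I_n -> R)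
    (hG : is_pcfg (polynomial_grammar p q qs))
    (K : fieldType) (D F : set K)
    (hD : infinite_set D) (hF : free_constants F) :
  let G := polynomial_grammar p q qs in
  let pi_ := monomial_prob q qs in
  let L := linear_grammar p pi_ in
  (forall m : monomial n,
     (\esum_(v in [set v : seq (symbol 'I_n) |
                    forall i, count_mem (Var i) v = val m i])
        prob_from G PV v)%E = (pi_ m)%:E) /\
  (q < 1 -> is_pcfg L) /\
  (forall (k : nat) (m : 'I_k -> monomial n) (s : 'I_k -> seq 'I_n),
     injective m ->
     (forall j, spells (s j) (m j)) ->
     let w := sum_string [seq s j | j <- enum 'I_k] in
     let w' := sum_string [seq [:: m j] | j <- enum 'I_k] in
     expr_prob G D F w = expr_prob L D F w' /\
     expr_prob G D F w =
       (\sum_(I : {set 'I_k})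
          (-1) ^+ #|I| * ((1 - p) / (1 - p * \sum_(j in ~: I) pi_ (m j))))%:E).
Proof.
move=> G pi_ L; split; first exact: (esum_prob_from_spells hG).
split; first exact: (is_pcfg_monomial_grammar hG).
move=> k m s minj sm w w'.
have p01 : 0 <= p <= 1 by exact: (hG.1 PE_sum).
have pi0 : forall m, 0 <= pi_ m by exact: (monomial_prob_ge0 hG).
pose c j := (1 - p) * p ^+ j.
have c0 j : 0 <= c j.
  by have /andP[p0 p1] := p01; rewrite mulr_ge0 ?exprn_ge0 ?subr_ge0.
pose ms := map m (enum 'I_k).
have wE : expr_prob G D F w =
    (\esum_(ms' in [set ms' : seq (monomial n) | ms' =i ms])
       (c (size ms') * \prod_(m <- ms') pi_ m)%:E)%E.
  pose us := [seq (exist _ (s j) (spells_nonempty (sm j)) : nonempty_word n)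
    | j <- enum 'I_k].
  have -> : w = sum_string (map val us).
    by rewrite -map_comp; congr sum_string; apply: eq_map.
  have usms : map (@counts n) us = ms.
    by rewrite -map_comp; apply: eq_map => j; exact/counts_spells/sm.
  rewrite (expr_prob_polynomial hG)// usms.
  (* Group the words by their monomials; each group has total weight [pi_] by the count in part
     (a). *)
  rewrite -(@esum_prod_group _ _ _ (@counts n)
    (fun u => word_prob q qs (val u)))//.
  - by move=> u; exact: (word_prob_ge0 hG).
  - exact: (esum_word_prob_counts hG).
have w'E : w' = sum_string (map (fun m => [:: m]) ms).
  by rewrite -map_comp; congr sum_string; apply: eq_map.
split; first by rewrite wE w'E (expr_prob_linear hG).
(* As [m] is injective, sequences with the same set of entries as [ms] correspond to words over the
   indices in which every index occurs. *)
rewrite wE (@reindex_esum _ _ _ [set js : seq 'I_k | forall j, j \in js] _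
  (map m)).
  rewrite -esum_surj_words//; last exact: (sum_monomial_prob_le1 hG).
  by apply: eq_esum => js _; rewrite size_map big_map.
split.
- move=> js /= js_all y; apply/mapP/mapP => -[j _ ->]; exists j => //.
  by rewrite mem_enum.
- by move=> js js' _ _; exact: inj_map.
- move=> ms' /= e.
  have ms'm y : y \in ms' -> exists j, m j = y.
    by rewrite e => /mapP[j _ ->]; exists j.
  (* A preimage under [map m] is built entry by entry, since every entry of [ms'] is a value of
     [m]. *)
  have [js ejs] : exists js, ms' = map m js.
    elim: ms' ms'm {e} => [|y ms' IH] ms'm; first by exists [::].
    have [|js ->] := IH.
      by move=> z zms'; apply: ms'm; rewrite inE zms' orbT.
    by have [j <-] := ms'm y (mem_head _ _); exists (j :: js).
  exists js => // j.
  by rewrite -(mem_map minj) -ejs e map_f// mem_enum.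
Qed.
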